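(* Let $G$ be a Lie group, $H\subset G$ a closed subgroup, $X:=G/H$, and $\mu$ a relatively $G$-invariant measure on $X$. Let $(V,v_0),(V',v_0')\in\tilde{\mathcal{V}}(G,H)$ be equivalent, $(V,v_0)\sim(V',v_0')$. Then the families of probability measures on $X$ generated from $(V,v_0)$ and from $(V',v_0')$ coincide as sets of measures: $\mathcal{P}_{(V,v_0)}=\mathcal{P}_{(V',v_0')}$.
   Context: A (finite dimensional real) representation of a Lie group $G$ is a finite dimensional real vector space $V$ with a Lie group homomorphism $\rho:G\to GL(V)$; write $gv:=\rho(g)v$. $V^\vee$ is the dual space, with pairing $\langle\cdot,\cdot\rangle$. $V^H:=\{v\in V: hv=v \text{ for all } h\in H\}$. A vector $v\in V$ is cyclic if $\operatorname{span}\{gv: g\in G\}=V$. $\tilde{\mathcal{V}}(G)$ is the collection of pairs $(V,v_0)$ where $V$ is a finite dimensional real representation of $G$ and $v_0\in V$ is cyclic; $\tilde{\mathcal{V}}(G,H):=\{(V,v_0)\in\tilde{\mathcal{V}}(G): v_0\in V^H\}$. Elements $(V,v_0),(V',v_0')$ are equivalent, written $(V,v_0)\sim(V',v_0')$, if there is a $G$-equivariant linear isomorphism $\psi:V\to V'$ with $\psi(v_0)=v_0'$. $\Omega_0(G,H):=\{\chi:G\to\mathbb{R}_{>0} : \chi \text{ is a continuous group homomorphism},\ \chi|_H=1\}$. A relatively $G$-invariant measure on $X=G/H$ is a nonzero Radon measure $\mu$ such that each $g\in G$ translates $\mu$ to a positive multiple $c(g)\mu$, with $c:G\to\mathbb{R}_{>0}$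 a continuous homomorphism. The family generated from a pair $(V,v_0)$ with $v_0\in V^H$: for $\theta=(\xi,\chi)\in V^\vee\times\Omega_0(G,H)$ define the measure $\tilde p_\theta$ on $X$ by $d\tilde p_\theta(x):=\exp(-\langle\xi,xv_0\rangle)\,\chi(x)\,d\mu(x)$; here $xv_0:=gv_0$ and $\chi(x):=\chi(g)$ for $x=gH$, which are well defined since $v_0$ is $H$-fixed and $\chi|_H=1$. Put $\Theta:=\{\theta\in V^\vee\times\Omega_0(G,H): \int_X d\tilde p_\theta<\infty\}$, $\varphi(\theta):=\log\int_X d\tilde p_\theta$ and $dp_\theta:=e^{-\varphi(\theta)}d\tilde p_\theta$ for $\theta\in\Theta$, and $\mathcal{P}_{(V,v_0)}:=\{p_\theta\}_{\theta\in\Theta}$. *)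

(* Defs.v *)
From HB Require Import structures.
From mathcomp Require Import all_boot all_order all_algebra generic_quotient.
From mathcomp Require Import all_classical all_reals all_analysis.
From mathcomp Require Import measurable_realfun.

Set Implicit Arguments.
Unset Strict Implicit.
Unset Printing Implicit Defensive.

Import Order.TTheory GRing.Theory Num.Theory.
Import numFieldNormedType.Exports.

Local Open Scope classical_set_scope.
Local Open Scope ring_scope.

(* U is meant to be open: derivatives at a point of U involve the values of f
   on a whole neighbourhood of that point. *)
Fixpoint Ck (R : realType) (m k : nat) (U : set 'rV[R]_m) (f : 'rV[R]_m -> R^o)
    : Prop :=
  (forall x, U x -> {for x, continuous f}) /\
  match k with
  | 0 => True
  | k'.+1 => forall i : 'I_m,
      (forall x, U x -> derivable f x (delta_mx ord0 i)) /\
      Ck k' U ('D_(delta_mx ord0 i) f)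
  end.

Definition smooth_on (R : realType) (m : nat) (U : set 'rV[R]_m)
    (f : 'rV[R]_m -> R^o) : Prop :=
  forall k, Ck k U f.

Definition smooth_map_on (R : realType) (m p : nat) (U : set 'rV[R]_m)
    (f : 'rV[R]_m -> 'rV[R]_p) : Prop :=
  forall j : 'I_p, smooth_on U (fun x => f x ord0 j).

(* A chart is a homeomorphism between the open sets [chart_dom] and
   [chart_img]; outside of these, both maps take junk values. *)
Record chart (R : realType) (n : nat) (M : topologicalType) := Chart {
  chart_dom : set M;
  chart_fun :> M -> 'rV[R]_n;
  chart_inv : 'rV[R]_n -> M;
  chart_open_dom : open chart_dom;
  chart_open_img : open (chart_fun @` chart_dom);
  chart_cont : forall x, chart_dom x -> {for x, continuous chart_fun};
  chart_inv_cont : forall y, (chart_fun @` chart_dom) y ->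
    {for y, continuous chart_inv};
  chart_funK : forall x, chart_dom x -> chart_inv (chart_fun x) = x
}.

Definition chart_img (R : realType) (n : nat) (M : topologicalType)
    (c : chart R n M) : set 'rV[R]_n :=
  c @` chart_dom c.

Record smooth_atlas (R : realType) (n : nat) (M : topologicalType)
    (A : set (chart R n M)) : Prop := {
  atlas_cover : forall x, exists2 c, A c & chart_dom c x;
  atlas_compat : forall c d, A c -> A d ->
    smooth_map_on (c @` (chart_dom c `&` chart_dom d)) (d \o chart_inv c)
}.

(* Smoothness of the multiplication and of the inversion is expressed in the
   charts of the atlas; R^n x R^n is identified with R^(n + n) by row
   concatenation. *)
HB.mixin Record isLieGroup (R : realType) (n : nat) G
    of Topological G & Group G := {
  lie_atlas : set (chart R n G);
  lie_atlas_smooth : smooth_atlas lie_atlas;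
  lie_hausdorff : hausdorff_space G;
  lie_second_countable : @second_countable G;
  lie_mul_continuous : continuous (fun xy : G * G => (xy.1 * xy.2)%g);
  lie_mul_smooth : forall c d e : chart R n G,
    lie_atlas c -> lie_atlas d -> lie_atlas e ->
    smooth_map_on
      [set z : 'rV[R]_(n + n) |
        [/\ chart_img c (lsubmx z), chart_img d (rsubmx z) &
            chart_dom e (chart_inv c (lsubmx z) * chart_inv d (rsubmx z))%g]]
      (fun z => e (chart_inv c (lsubmx z) * chart_inv d (rsubmx z))%g);
  lie_inv_continuous : continuous (fun x : G => (x^-1)%g);
  lie_inv_smooth : forall c d : chart R n G, lie_atlas c -> lie_atlas d ->
    smooth_map_on
      [set z | chart_img c z /\ chart_dom d ((chart_inv c z)^-1)%g]
      (fun z => d ((chart_inv c z)^-1)%g)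
}.

#[short(type="lieGroupType")]
HB.structure Definition LieGroup (R : realType) (n : nat) :=
  {G of isLieGroup R n G & Topological G & Group G}.

Definition smooth_fun (R : realType) (n : nat) (G : lieGroupType R n)
    (f : G -> R^o) : Prop :=
  forall c : chart R n G, lie_atlas c ->
    smooth_on (chart_img c) (f \o chart_inv c).

(* A map to a finite-dimensional vector space is smooth when all its linear
   coordinates are. *)
Definition smooth_vect_fun (R : realType) (n : nat) (G : lieGroupType R n)
    (W : vectType R) (f : G -> W) : Prop :=
  forall l : 'Hom(W, R^o), smooth_fun (fun g => l (f g)).

(* [rep_act] lands in GL(V), which is open in the vector space End(V):
   [rep_act g^-1] is inverse to [rep_act g]. *)
Record representation (R : realType) (n : nat) (G : lieGroupType R n) :=
  Representation {
    rep_space :> vectType R;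
    rep_act : G -> 'End(rep_space);
    rep_act1 : rep_act 1%g = \1%VF;
    rep_actM : forall g h, rep_act (g * h)%g = (rep_act g \o rep_act h)%VF;
    rep_smooth : smooth_vect_fun rep_act
  }.

Definition cyclic_vector (R : realType) (n : nat) (G : lieGroupType R n)
    (V : representation G) (v0 : V) : Prop :=
  forall v : V, exists s : seq G, v \in <<[seq rep_act V g v0 | g <- s]>>%VS.

Record cyclic_pair (R : realType) (n : nat) (G : lieGroupType R n) :=
  CyclicPair {
    cp_rep :> representation G;
    cp_vec : cp_rep;
    cp_cyclic : cyclic_vector cp_vec
  }.

Definition fixed_by (R : realType) (n : nat) (G : lieGroupType R n)
    (H : set G) (V : representation G) : set V :=
  [set v | forall h, H h -> rep_act V h v = v].

Definition pair_fixed_by (R : realType) (n : nat) (G : lieGroupType R n)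
    (H : set G) (P : cyclic_pair G) : Prop :=
  fixed_by H (cp_vec P).

Definition pair_equiv (R : realType) (n : nat) (G : lieGroupType R n)
    (P P' : cyclic_pair G) : Prop :=
  exists psi : 'Hom(P, P'),
    [/\ bijective psi,
        forall g v, psi (rep_act P g v) = rep_act P' g (psi v) &
        psi (cp_vec P) = cp_vec P'].

Record closed_subgroup (R : realType) (n : nat) (G : lieGroupType R n) :=
  ClosedSubgroup {
    subgroup_set :> set G;
    subgroup1 : subgroup_set 1%g;
    subgroupM : forall g h, subgroup_set g -> subgroup_set h ->
      subgroup_set (g * h)%g;
    subgroupV : forall g, subgroup_set g -> subgroup_set (g^-1)%g;
    subgroup_closed : closed subgroup_set
  }.

Section homogeneous_space.
Variables (R : realType) (n : nat) (G : lieGroupType R n).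
Variable H : closed_subgroup G.

Definition coset_rel : rel G := fun g h => `[< subgroup_set H (g^-1 * h)%g >].

Lemma coset_rel_refl : reflexive coset_rel.
Proof. by move=> g; apply/asboolP; rewrite mulVg; exact: subgroup1. Qed.

Lemma coset_rel_sym : symmetric coset_rel.
Proof.
suff coset_relC g h : coset_rel g h -> coset_rel h g.
  by move=> g h; apply/idP/idP; exact: coset_relC.
move=> /asboolP/subgroupV; rewrite invgM invgK => gh; exact/asboolP.
Qed.

Lemma coset_rel_trans : transitive coset_rel.
Proof.
move=> g h k /asboolP hg /asboolP gk; apply/asboolP.
by have := subgroupM hg gk; rewrite mulgA mulgK.
Qed.

Canonical coset_equiv :=
  EquivRel coset_rel coset_rel_refl coset_rel_sym coset_rel_trans.

Definition homog_space : Type := quotient_topology {eq_quot coset_equiv}%qT.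

HB.instance Definition _ := Topological.on homog_space.
HB.instance Definition _ := Quotient.on homog_space.
HB.instance Definition _ :=
  isPointed.Build homog_space (\pi_homog_space (1%g : G))%qT.

Definition coset_act (g : G) (x : homog_space) : homog_space :=
  (\pi_homog_space (g * repr x)%g)%qT.

Definition borel_homog := g_sigma_algebraType (@open homog_space).

Definition radon_measure (mu : {measure set borel_homog -> \bar R}) : Prop :=
  [/\ forall K : set homog_space, compact K -> (mu K < +oo)%E,
      forall A : set borel_homog, measurable A ->
        mu A = ereal_inf [set mu U | U in
          [set U : set homog_space | open U /\ A `<=` U]] &
      forall U : set homog_space, open U ->
        mu U = ereal_sup [set mu K | K in
          [set K : set homog_space | compact K /\ K `<=` U]]].

Definition pos_character (c : G -> R) : Prop :=
  [/\ continuous c, forall g, 0 < c g & forall g h, c (g * h)%g = c g * c h].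

Definition relatively_invariant (mu : {measure set borel_homog -> \bar R})
    : Prop :=
  [/\ radon_measure mu,
      exists2 A : set borel_homog, measurable A & mu A <> 0%E &
      exists2 c : G -> R, pos_character c &
        forall g (A : set borel_homog), measurable A ->
          pushforward mu (coset_act g : borel_homog -> borel_homog) A
          = ((c g)%:E * mu A)%E].

Definition Omega0 : set (G -> R) :=
  [set chi | pos_character chi /\ forall h, subgroup_set H h -> chi h = 1].

End homogeneous_space.

Section family.
Variables (R : realType) (n : nat) (G : lieGroupType R n).
Variables (H : closed_subgroup G) (mu : {measure set (borel_homog H) -> \bar R}).
Variable P : cyclic_pair G.

Local Notation X := (homog_space H).
Local Notation param := ('Hom(P, R^o) * (G -> R))%type.
Implicit Types (theta : param) (x : X).

(* The values at a coset are computed at its canonical representative; see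
   [coset_vec_pi] and [coset_char_pi] for the independence of this choice. *)
Definition coset_vec x : P := rep_act P (repr x) (cp_vec P).

Definition coset_char (chi : G -> R) x : R := chi (repr x).

Definition density theta x : R :=
  expR (- (theta.1 (coset_vec x) : R)) * coset_char theta.2 x.

Definition ptilde theta (A : set (borel_homog H)) : \bar R :=
  (\int[mu]_(x in A) (density theta x)%:E)%E.

Definition Theta : set param :=
  [set theta | Omega0 H theta.2 /\ (ptilde theta setT < +oo)%E].

Definition log_partition theta : R := ln (fine (ptilde theta setT)).

Definition p_ theta (A : set (borel_homog H)) : \bar R :=
  ((expR (- log_partition theta))%:E * ptilde theta A)%E.

(* Measures are compared with [p_ theta] on Borel sets only, as the integral
   over a nonmeasurable set is a junk value. By [p_probability], every theta in
   [Theta] contributes a measure to the family. *)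
Definition generated_family : set (probability (borel_homog H) R) :=
  [set nu | exists2 theta, Theta theta &
    forall A, measurable A -> nu A = p_ theta A].

End family.

Lemma smooth_fun_continuous (R : realType) (n : nat) (G : lieGroupType R n)
    (f : G -> R^o) : smooth_fun f -> continuous f.
Proof.
move=> sf x; have [c Ac cx] := atlas_cover (@lie_atlas_smooth R n G) x.
have [/= fc _] := sf c Ac 0%N.
have ccx : chart_img c (c x) by exists x.
have fcx : {for x, continuous ((f \o chart_inv c) \o c)}.
  by apply: continuous_comp; [exact: chart_cont|exact: fc].
rewrite /continuous_at -[in X in _ --> X](chart_funK cx).
apply: cvg_trans fcx; apply: near_eq_cvg.
have : nbhs x (chart_dom c) by apply: open_nbhs_nbhs; split => //; exact: chart_open_dom.
by apply: filterS => y cy /=; rewrite chart_funK.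
Qed.

Lemma rep_coef_continuous (R : realType) (n : nat) (G : lieGroupType R n)
    (V : representation G) (xi : 'Hom(V, R^o)) (v : V) :
  continuous (fun g : G => xi (rep_act V g v) : R^o).
Proof.
pose ev (A : 'End(V)) : R^o := xi (A v).
have evlin : linear ev.
  by move=> a A B; rewrite /ev add_lfunE scale_lfunE linearP.
pose evL : {linear 'End(V) -> R^o} := HB.pack ev
  (GRing.isLinear.Build _ _ _ _ _ evlin).
have /smooth_fun_continuous := rep_smooth (r := V) (linfun evL).
by under eq_fun do rewrite lfunE.
Qed.

Section cosets.
Variables (R : realType) (n : nat) (G : lieGroupType R n).
Variable H : closed_subgroup G.
Local Notation X := (homog_space H).

Lemma repr_pi_coset (g : G) :
  exists2 h, subgroup_set H h & repr (\pi_X g)%qT = (g * h)%g.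
Proof.
have /eqmodP/asboolP Hg : (g = repr (\pi_X g)%qT %[mod X])%qT by rewrite reprK.
by exists (g^-1 * repr (\pi_X g)%qT)%g => //; rewrite mulVKg.
Qed.

Lemma coset_act_pi (g h : G) :
  coset_act g (\pi_X h)%qT = (\pi_X (g * h)%g)%qT.
Proof.
have [k Hk kE] := repr_pi_coset h.
apply/eqmodP/asboolP; rewrite kE invgM !mulgA.
have -> : ((h * k)^-1 * g^-1 * g * h)%g = (k^-1)%g.
  by rewrite mulgVK invgM mulgVK.
exact: subgroupV.
Qed.

Lemma coset_char_pi (chi : G -> R) (g : G) :
  Omega0 H chi -> coset_char chi (\pi_X g)%qT = chi g.
Proof.
move=> [[_ _ chiM] chi1]; rewrite /coset_char.
by have [h Hh ->] := repr_pi_coset g; rewrite chiM (chi1 _ Hh) mulr1.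
Qed.

Lemma coset_vec_pi (P : cyclic_pair G) (g : G) :
  pair_fixed_by H P ->
  coset_vec P (\pi_X g)%qT = rep_act P g (cp_vec P).
Proof.
move=> fP; rewrite /coset_vec.
have [h Hh ->] := repr_pi_coset g; rewrite rep_actM lfunE /=.
by rewrite (fP _ Hh).
Qed.

End cosets.

Section probability_family.
Variables (R : realType) (n : nat) (G : lieGroupType R n).
Variables (H : closed_subgroup G) (mu : {measure set (borel_homog H) -> \bar R}).
Variable P : cyclic_pair G.
Local Notation X := (homog_space H).
Variable theta : 'Hom(P, R^o) * (G -> R).

Lemma density_measurable : pair_fixed_by H P -> Omega0 H theta.2 ->
  measurable_fun [set: borel_homog H] (density theta : borel_homog H -> R).
Proof.
move=> fP Ochi.
have cont : continuous (density theta : X -> R).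
  apply/quotient_continuous.
  have -> : density theta \o (\pi_X)%qT =
      (fun g => expR (- (theta.1 (rep_act P g (cp_vec P)) : R)) * theta.2 g).
    by apply/funext => g; rewrite /density /= coset_vec_pi// coset_char_pi.
  move=> g; have [[chic _ _] _] := Ochi; apply: cvgM; last exact: chic.
  apply: continuous_comp; last exact: continuous_expR.
  by apply: continuousN; exact: rep_coef_continuous.
apply: (measurability _ (measurable_realfun.RGenOInfty.measurableE R)) => _ [_ [x ->] <-].
rewrite setTI; apply: sub_sigma_algebra; move/continuousP: cont; apply.
exact: interval_open.
Qed.

Hypotheses (fP : pair_fixed_by H P) (mu_inv : relatively_invariant mu).
Hypothesis Ttheta : Theta mu theta.

Let density_gt0 x : 0 < density (H := H) theta x.
Proof.
have [[[_ chi0 _] _] _] := Ttheta.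
by rewrite mulr_gt0 ?expR_gt0// chi0.
Qed.

Let mdensity : measurable_fun [set: borel_homog H]
  (fun x : borel_homog H => (density theta x)%:E).
Proof.
by apply/measurable_EFinP; apply: density_measurable => //; case: Ttheta.
Qed.

Let ptilde_fin_num : ptilde mu theta setT \is a fin_num.
Proof.
rewrite ge0_fin_numE; first by case: Ttheta.
by apply: integral_ge0 => x _; rewrite lee_fin ltW.
Qed.

Let ptilde_gt0 : 0 < fine (ptilde mu theta setT).
Proof.
apply: fine_gt0; apply/andP; split; last by case: Ttheta.
rewrite lt0e; apply/andP; split; last first.
  by apply: integral_ge0 => x _; rewrite lee_fin ltW.
apply/eqP => p0; have [_ [A mA +] _] := mu_inv; apply.
have : ae_eq mu setT (fun x : borel_homog H => (density theta x)%:E) (cst 0%E).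
  apply/ae_eq_integral_abs => //; rewrite -[RHS]p0; apply: eq_integral => x _.
  by rewrite gee0_abs// lee_fin ltW.
move=> [N [mN N0 sN]]; apply/eqP; rewrite -measure_le0 -N0.
apply: le_measure; rewrite ?inE// => x _; apply: sN => /= /(_ Logic.I) /eqP.
by rewrite eqe gt_eqF.
Qed.

Lemma p_probability : exists nu : probability (borel_homog H) R,
  forall A, measurable A -> nu A = p_ mu theta A.
Proof.
have p0 : p_ mu theta set0 = 0%E by rewrite /p_ /ptilde integral_set0 mule0.
have pge0 A : (0 <= p_ mu theta A)%E.
  apply: mule_ge0; first by rewrite lee_fin expR_ge0.
  by apply: integral_ge0 => x _; rewrite lee_fin ltW.
have psig : semi_sigma_additive (p_ mu theta).
  move=> F mF tF mUF.
  have -> : (fun k => \sum_(0 <= i < k) p_ mu theta (F i))%E =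
      (fun k => (expR (- log_partition mu theta))%:E *
        \sum_(0 <= i < k) ptilde mu theta (F i))%E.
    apply/funext => k; rewrite ge0_sume_distrr// => i _.
    by apply: integral_ge0 => x _; rewrite lee_fin ltW.
  apply: cvgeZl => //; apply: semi_sigma_additive_nng_induced => // x.
  by rewrite lee_fin ltW.
have pT : p_ mu theta setT = 1%E.
  rewrite /p_ -[X in (_ * X)%E](fineK ptilde_fin_num) -EFinM.
  by rewrite /log_partition expRN lnK ?posrE// mulVf// gt_eqF.
pose m := isMeasure.Build _ _ R (p_ mu theta) p0 pge0 psig.
pose nu : {measure set (borel_homog H) -> \bar R} := HB.pack (p_ mu theta) m.
pose pm := Measure_isProbability.Build _ _ _ nu pT.
pose pp : probability (borel_homog H) R := HB.pack (p_ mu theta) m pm.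
by exists pp.
Qed.

End probability_family.

(* Main.v *)
Require Import Defs.
From mathcomp Require Import all_boot all_order all_algebra.
From mathcomp Require Import all_classical all_reals all_analysis.

(** Let psi : V -> V' be an equivariant linear map with psi v0 = v0'. It sends
    the orbit point x v0 to x v0' for every x in X, so a linear form xi' on V'
    satisfies <xi', x v0'> = <xi' o psi, x v0>: the parameters (xi', chi) on V'
    and (xi' o psi, chi) on V have the same density with respect to mu
    ([density_comp]), hence the same normalization and the same measure. This
    yields one inclusion between the two families ([generated_family_sub]).
    When psi is bijective, its inverse is again such a map
    ([pair_equiv_sym]), which yields the other one. *)

Set Implicit Arguments.
Unset Strict Implicit.
Unset Printing Implicit Defensive.
Local Open Scope classical_set_scope.
Local Open Scope ring_scope.

(** The inverse bijection f of psi is a mere function; injectivity of psi makes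
    it agree with the linear map psi^-1, and the equations for psi then transfer
    to it by cancellation. *)
Lemma pair_equiv_sym (R : realType) (n : nat) (G : lieGroupType R n)
    (P P' : cyclic_pair G) : pair_equiv P P' -> pair_equiv P' P.
Proof.
move=> [psi [[f psiK fK] psiG psi0]].
have kpsi : lker psi == 0%VS by apply/lker0P; exact: can_inj psiK.
have VE w : (psi^-1)%VF w = f w by rewrite -{1}(fK w) lker0_lfunK.
exists (psi^-1)%VF; split.
- by exists psi => w; rewrite VE.
- by move=> g w; rewrite !VE -{1}(fK w) -psiG psiK.
- by rewrite VE -psi0 psiK.
Qed.

Section equivariant_map.
Variables (R : realType) (n : nat) (G : lieGroupType R n).
Variables (H : closed_subgroup G) (P P' : cyclic_pair G).
Variable psi : 'Hom(P, P').
Hypothesis psiG : forall g v, psi (rep_act P g v) = rep_act P' g (psi v).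
Hypothesis psi0 : psi (cp_vec P) = cp_vec P'.

(** The density sees xi only through its values on the orbit of the base
    vector, and psi maps one orbit onto the other, coset by coset. *)
Lemma density_comp (xi : 'Hom(P', R^o)) (chi : G -> R) :
  density (H := H) ((xi \o psi)%VF, chi) = density (xi, chi).
Proof.
by apply/funext => x; rewrite /density /coset_vec /= lfunE /= psiG psi0.
Qed.

(** The inclusion is contravariant in psi because parameters are linear forms:
    they pull back along psi from V' to V, the character being kept. *)
Lemma generated_family_sub (mu : {measure set (borel_homog H) -> \bar R}) :
  generated_family mu P' `<=` generated_family mu P.
Proof.
move=> nu [[xi chi] [/= Ochi fin] nuE].
have ptildeE : ptilde mu ((xi \o psi)%VF, chi) = ptilde mu (xi, chi).
  by rewrite /ptilde density_comp.
have Ttheta : Theta mu ((xi \o psi)%VF, chi).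
  by split; [exact: Ochi|rewrite ptildeE; exact: fin].
exists ((xi \o psi)%VF, chi); first exact: Ttheta.
by move=> A mA; rewrite (nuE A mA) /p_ /log_partition ptildeE.
Qed.

End equivariant_map.

Theorem theorem2 (R : realType) (n : nat) (G : lieGroupType R n)
    (H : closed_subgroup G)
    (mu : {measure set (borel_homog H) -> \bar R})
    (mu_inv : relatively_invariant mu)
    (P P' : cyclic_pair G)
    (fP : pair_fixed_by H P) (fP' : pair_fixed_by H P')
    (PP' : pair_equiv P P') :
  generated_family mu P = generated_family mu P'.
Proof.
have [phi [_ phiG phi0]] := pair_equiv_sym PP'.
have [psi [_ psiG psi0]] := PP'.
apply/seteqP; split.
- exact: (generated_family_sub phiG phi0).
- exact: (generated_family_sub psiG psi0).
Qed.
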